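(* Let $H\in\mathbb{R}^{R\times N}$ and let $\lambda\in\left[0,\frac{2}{\|H^\top H\|_{\mathrm F}}\right]$ if $H\neq O$, and $\lambda\in[0,\infty)$ if $H=O$. Let $S_{H,\lambda}:\mathbb{R}^{M\times R}\to\mathbb{R}^{M\times R}$ be defined for all $W\in\mathbb{R}^{M\times R}$ by $$S_{H,\lambda}(W):=P_{\mathbb{R}_+^{M\times R}}\left[W-\lambda\nabla_Wf(W,H)\right]=P_{\mathbb{R}_+^{M\times R}}\left[W-\lambda(WH-V)H^\top\right].$$ Then $S_{H,\lambda}$ is nonexpansive, i.e., $\|S_{H,\lambda}(W_1)-S_{H,\lambda}(W_2)\|_{\mathrm F}\le\|W_1-W_2\|_{\mathrm F}$ for all $W_1,W_2\in\mathbb{R}^{M\times R}$; and, if $\lambda>0$, then $$\mathrm{Fix}(S_{H,\lambda})=\operatorname*{argmin}_{W\in\mathbb{R}_+^{M\times R}}f(W,H).$$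
   Context: $M,N,R$ are positive integers with $R<\min\{M,N\}$, and $V\in\mathbb{R}_+^{M\times N}$ is a given matrix, where $\mathbb{R}_+^{m\times n}$ denotes the set of entrywise nonnegative real $m\times n$ matrices. $O$ is the zero matrix and $\|\cdot\|_{\mathrm F}$ is the Frobenius norm. $f(W,H):=\frac12\|V-WH\|_{\mathrm F}^2$ for $(W,H)\in\mathbb{R}^{M\times R}\times\mathbb{R}^{R\times N}$, and $\nabla_Wf(W,H)=(WH-V)H^\top$ is the gradient of $f(\cdot,H)$ at $W$. $P_K$ denotes the metric projection (w.r.t. $\|\cdot\|_{\mathrm F}$) onto a nonempty closed convex set $K$. $\mathrm{Fix}(S):=\{W:S(W)=W\}$. $\operatorname{argmin}_{W\in K}g(W)$ is the set of all minimizers of $g$ over $K$. *)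

(* Defs.v *)
From HB Require Import structures.
From mathcomp Require Import all_boot all_order all_algebra.
From mathcomp Require Import all_classical all_reals all_analysis.

Set Implicit Arguments.
Unset Strict Implicit.
Unset Printing Implicit Defensive.

Import Order.TTheory GRing.Theory Num.Theory.
Import numFieldNormedType.Exports.

Local Open Scope classical_set_scope.
Local Open Scope ring_scope.

(* The norm `|A| provided by the library on matrices is the sup norm. *)
Definition frobenius (R : realType) (m n : nat) (A : 'M[R]_(m, n)) : R :=
  Num.sqrt (\sum_i \sum_j A i j ^+ 2).

Definition nonneg_mx (R : realType) (m n : nat) : set 'M[R]_(m, n) :=
  [set A | A \is a mxOver Num.nneg].

Definition argmin (R : realType) (T : Type) (K : set T) (g : T -> R) : set T :=
  [set x | K x /\ forall y, K y -> g x <= g y].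

Definition fixed_points (T : Type) (S : T -> T) : set T := [set x | S x = x].

(* A nearest point of K, which exists and is unique when K is nonempty, closed
   and convex; 0 is a dummy value returned when K has no nearest point to A. *)
Definition metric_proj (R : realType) (m n : nat) (K : set 'M[R]_(m, n))
    (A : 'M[R]_(m, n)) : 'M[R]_(m, n) :=
  xget 0 (argmin K (fun B => frobenius (A - B))).

(* The matrix of the partial derivatives of g at A. *)
Definition gradient (R : realType) (m n : nat) (g : 'M[R]_(m, n) -> R)
    (A : 'M[R]_(m, n)) : 'M[R]_(m, n) :=
  \matrix_(i, j) 'D_(delta_mx i j) g A.

Definition nmf_loss (R : realType) (M N r : nat) (V : 'M[R]_(M, N))
    (W : 'M[R]_(M, r)) (H : 'M[R]_(r, N)) : R :=
  2^-1 * frobenius (V - W *m H) ^+ 2.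

Definition nmf_step (R : realType) (M N r : nat) (V : 'M[R]_(M, N))
    (H : 'M[R]_(r, N)) (lambda : R) (W : 'M[R]_(M, r)) : 'M[R]_(M, r) :=
  metric_proj (@nonneg_mx R M r)
    (W - lambda *: gradient (fun W' => nmf_loss V W' H) W).

(* Main.v *)
(** The projection onto the nonnegative cone is the entrywise positive part, which
    is 1-Lipschitz. For D = W1 - W2, the gradient step maps D to
    D - lambda D H H^T, whose squared norm is
    |D|^2 - 2 lambda |D H|^2 + lambda^2 |D H H^T|^2; Cauchy-Schwarz gives
    |D H H^T|^2 = <D H, D H (H^T H)> <= |H^T H| |D H|^2, hence nonexpansiveness.
    The loss is an exact quadratic along segments, so minimality at W >= 0 is the
    variational inequality <grad, B - W> >= 0 for all B >= 0, which holds exactly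
    when W is a fixed point. *)

Require Import Defs.
From HB Require Import structures.
From mathcomp Require Import all_boot all_order all_algebra.
From mathcomp Require Import all_classical all_reals all_analysis.
From mathcomp Require Import ring lra.

Set Implicit Arguments.
Unset Strict Implicit.
Unset Printing Implicit Defensive.

Import Order.TTheory GRing.Theory Num.Theory.
Import numFieldNormedType.Exports.

Local Open Scope classical_set_scope.
Local Open Scope ring_scope.

(** * The Frobenius inner product and its inequalities *)

Definition mxdot (R : realType) (m n : nat) (A B : 'M[R]_(m, n)) : R :=
  \tr (A *m B^T).

Section Frobenius.
Context {R : realType}.

Lemma mxdotE m n (A B : 'M[R]_(m, n)) :
  mxdot A B = \sum_i \sum_j A i j * B i j.
Proof.
by apply: eq_bigr => i _; rewrite mxE; apply: eq_bigr => j _; rewrite mxE.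
Qed.

Lemma mxdotC m n (A B : 'M[R]_(m, n)) : mxdot A B = mxdot B A.
Proof. by rewrite /mxdot -mxtrace_tr trmx_mul trmxK. Qed.

Lemma mxdot_ge0 m n (A : 'M[R]_(m, n)) : 0 <= mxdot A A.
Proof.
rewrite mxdotE; apply: sumr_ge0 => i _; apply: sumr_ge0 => j _.
by rewrite -expr2 sqr_ge0.
Qed.

Lemma mxdot_eq0 m n (A : 'M[R]_(m, n)) : mxdot A A = 0 -> A = 0.
Proof.
have sq_ge0 i j : 0 <= A i j * A i j by rewrite -expr2 sqr_ge0.
rewrite mxdotE => /psumr_eq0P rows0; apply/matrixP => i j; rewrite mxE.
have /psumr_eq0P row0 : \sum_j A i j * A i j = 0.
  by apply: rows0 => // k _; apply: sumr_ge0.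
by apply/eqP; rewrite -sqrf_eq0 expr2 row0.
Qed.

Lemma mxdot_mulmxl m n p (A : 'M[R]_(m, n)) (B : 'M[R]_(n, p)) C :
  mxdot (A *m B) C = mxdot A (C *m B^T).
Proof. by rewrite /mxdot trmx_mul trmxK mulmxA. Qed.

Lemma mxdot_add_scale m n (t : R) (A B : 'M[R]_(m, n)) :
  mxdot (A + t *: B) (A + t *: B) =
  mxdot A A + 2 * t * mxdot A B + t ^+ 2 * mxdot B B.
Proof.
have cross : mxdot B A = mxdot A B by exact: mxdotC.
rewrite /mxdot linearD /= linearZ /= mulmxDl !mulmxDr -!scalemxAl -!scalemxAr.
rewrite !mxtraceD !mxtraceZ -!/(mxdot _ _) cross; ring.
Qed.

Lemma frobenius_ge0 m n (A : 'M[R]_(m, n)) : 0 <= frobenius A.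
Proof. exact: sqrtr_ge0. Qed.

Lemma frobeniusE m n (A : 'M[R]_(m, n)) : frobenius A = Num.sqrt (mxdot A A).
Proof.
by rewrite mxdotE; congr Num.sqrt.
Qed.

Lemma sqr_frobenius m n (A : 'M[R]_(m, n)) : frobenius A ^+ 2 = mxdot A A.
Proof. by rewrite frobeniusE sqr_sqrtr ?mxdot_ge0. Qed.

Lemma ler_frobenius m p n q (A : 'M[R]_(m, n)) (B : 'M[R]_(p, q)) :
  (frobenius A <= frobenius B) = (mxdot A A <= mxdot B B).
Proof. by rewrite !frobeniusE ler_sqrt ?mxdot_ge0. Qed.

Lemma mxdot_cauchy_schwarz m n (A B : 'M[R]_(m, n)) :
  mxdot A B ^+ 2 <= mxdot A A * mxdot B B.
Proof.
have [/mxdot_eq0->|B_neq0] := eqVneq (mxdot B B) 0.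
  by rewrite /mxdot trmx0 mulmx0 mxtrace0 mulmx0 mxtrace0 expr0n mulr0.
have B_gt0 : 0 < mxdot B B by rewrite lt_neqAle eq_sym B_neq0 mxdot_ge0.
(* The residual of [A] after projection onto the line of [B]; its squared norm times [mxdot B B] is
   the Cauchy-Schwarz gap. *)
have := mxdot_ge0 (A + (- (mxdot A B / mxdot B B)) *: B).
rewrite mxdot_add_scale -(pmulr_rge0 _ B_gt0) => discr_ge0; rewrite -subr_ge0.
move: discr_ge0; suff -> : mxdot B B * (mxdot A A + 2 * - (mxdot A B / mxdot B B) * mxdot A B +
    (- (mxdot A B / mxdot B B)) ^+ 2 * mxdot B B) =
    mxdot A A * mxdot B B - mxdot A B ^+ 2 by [].
by field.
Qed.

(** Each entry of the product pairs a row of [A] with a column of [B]; Cauchy-Schwarz on each pair,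
    summed over all pairs, factors into the two norms. *)
Lemma mxdot_mulmx_le m n p (A : 'M[R]_(m, n)) (B : 'M[R]_(n, p)) :
  mxdot (A *m B) (A *m B) <= mxdot A A * mxdot B B.
Proof.
rewrite (mxdotE A) (mxdotE B) mxdotE.
rewrite [\sum_k \sum_j B k j * B k j]exchange_big /= big_distrlr /=.
apply: ler_sum => i _; apply: ler_sum => j _.
have := mxdot_cauchy_schwarz (row i A) (col j B)^T.
rewrite !mxdotE !big_ord1 mxE -expr2.
by congr (is_true (_ ^+ 2 <= _ * _)); apply: eq_bigr => k _; rewrite !mxE.
Qed.

Lemma mxdot_gram_le m n p (A : 'M[R]_(m, n)) (H : 'M[R]_(p, n)) :
  mxdot (A *m H^T) (A *m H^T) <= frobenius (H^T *m H) * mxdot A A.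
Proof.
set G := H^T *m H.
have -> : mxdot (A *m H^T) (A *m H^T) = mxdot A (A *m G).
  by rewrite mxdot_mulmxl trmxK /G mulmxA.
have AA_ge0 := mxdot_ge0 A; have G_ge0 := frobenius_ge0 G.
(* The bound is obtained by comparing squares, which requires nonnegative sides. *)
have [AG_le0|AG_gt0] := leP (mxdot A (A *m G)) 0.
  by apply: (le_trans AG_le0); apply: mulr_ge0.
rewrite -ler_sqr ?nnegrE ?mulr_ge0 ?(ltW AG_gt0)//.
apply: (le_trans (mxdot_cauchy_schwarz _ _)).
rewrite exprMn sqr_frobenius mulrC expr2 mulrA ler_wpM2r// mulrC.
exact: mxdot_mulmx_le.
Qed.

End Frobenius.

(** * Projection onto the nonnegative cone *)

Section Projection.
Context {R : realType} {m n : nat}.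
Implicit Types A B : 'M[R]_(m, n).

Definition pospart A : 'M[R]_(m, n) := map_mx (Num.max 0) A.

Lemma nonneg_mxP A : nonneg_mx A <-> forall i j, 0 <= A i j.
Proof. by split=> [/mxOverP|A_ge0]; last apply/mxOverP. Qed.

Lemma pospart_nonneg A : nonneg_mx (pospart A).
Proof. by apply/nonneg_mxP => i j; rewrite mxE le_max lexx. Qed.

(** Entrywise, with p = max(0, a), the cross term (a - p)(b - p) is at most 0 for b >= 0. Keeping
    the square of [B - pospart A] yields uniqueness of the nearest point along with minimality. *)
Lemma pospart_nearest A B : nonneg_mx B ->
  mxdot (A - pospart A) (A - pospart A) + mxdot (B - pospart A) (B - pospart A)
  <= mxdot (A - B) (A - B).
Proof.
move=> /nonneg_mxP B_ge0; rewrite !mxdotE -big_split /=; apply: ler_sum => i _.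
rewrite -big_split /=; apply: ler_sum => j _; rewrite !mxE.
by have := B_ge0 i j; case: (leP 0 (A i j)) => *; nra.
Qed.

Lemma metric_proj_nonneg A : metric_proj (@nonneg_mx R m n) A = pospart A.
Proof.
rewrite /metric_proj.
suff -> : argmin (@nonneg_mx R m n) (fun B => frobenius (A - B)) =
    [set pospart A] 
    by rewrite (@xget_unique _ _ _ (pospart A)).
apply/seteqP; split=> [B [B_ge0 /(_ _ (pospart_nonneg A))]|_ ->] /=.
  rewrite ler_frobenius => B_min; have near := pospart_nearest A B_ge0.
  apply/eqP; rewrite -subr_eq0; apply/eqP/mxdot_eq0/eqP.
  by rewrite eq_le mxdot_ge0 andbT; lra.
split=> [|B B_ge0]; first exact: pospart_nonneg.
rewrite ler_frobenius; have := pospart_nearest A B_ge0.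
by have := mxdot_ge0 (B - pospart A); lra.
Qed.

Lemma pospart_nonexpansive A B :
  mxdot (pospart A - pospart B) (pospart A - pospart B)
  <= mxdot (A - B) (A - B).
Proof.
rewrite !mxdotE; apply: ler_sum => i _; apply: ler_sum => j _; rewrite !mxE.
move: (A i j) (B i j) => a b.
have := sqr_ge0 (a - b).
by case: (leP 0 a) => ?; case: (leP 0 b) => *; nra.
Qed.

End Projection.

Lemma segment_slope_ge0 (R : realFieldType) (a c : R) : 0 <= c ->
  (forall t, 0 <= t <= 1 -> 0 <= t * a + t ^+ 2 * c) -> 0 <= a.
Proof.
move=> c_ge0 segment; rewrite leNgt; apply/negP => a_lt0.
have den_gt0 : 0 < c - a by lra.
(* For small t the negative linear term dominates. The denominator [c - a] keeps t in [0, 1] and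
   stays positive even when c = 0. *)
have t01 : 0 <= - a / (c - a) <= 1.
  by rewrite divr_ge0 ?ler_pdivrMr//; lra.
have := segment _ t01.
have -> : - a / (c - a) * a + (- a / (c - a)) ^+ 2 * c = a ^+ 3 / (c - a) ^+ 2.
  by field; exact: lt0r_neq0.
rewrite pmulr_lge0 ?invr_gt0 ?exprn_gt0//.
by rewrite exprS pmulr_lge0 ?exprn_even_gt0//= ?lt_eqF// leNgt a_lt0.
Qed.

(** * The quadratic loss: gradient, gradient step and optimality *)

Section Loss.
Context {R : realType} {M N r : nat}.
Variables (V : 'M[R]_(M, N)) (H : 'M[R]_(r, N)).
Implicit Types W D : 'M[R]_(M, r).

Definition loss_grad W : 'M[R]_(M, r) := (W *m H - V) *m H^T.

Lemma nmf_loss_expand (t : R) W D :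
  nmf_loss V (W + t *: D) H =
  nmf_loss V W H + t * mxdot (loss_grad W) D
  + t ^+ 2 * (2^-1 * mxdot (D *m H) (D *m H)).
Proof.
rewrite /nmf_loss !sqr_frobenius.
have -> : V - (W + t *: D) *m H = (V - W *m H) + (- t) *: (D *m H).
  by rewrite mulmxDl -scalemxAl scaleNr opprD addrA.
rewrite mxdot_add_scale.
have -> : mxdot (V - W *m H) (D *m H) = - mxdot (loss_grad W) D.
  rewrite mxdotC mxdot_mulmxl mxdotC /loss_grad -opprB mulNmx /mxdot mulNmx.
  by rewrite raddfN.
by field.
Qed.

Lemma mxdot_delta m n (A : 'M[R]_(m, n)) i j : mxdot A (delta_mx i j) = A i j.
Proof.
rewrite mxdotE (bigD1 i)//= (bigD1 j)//= mxE !eqxx mulr1 !big1 ?addr0//.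
  move=> k kNi; rewrite big1// => l _.
  by rewrite mxE (negbTE kNi) mulr0.
by move=> l lNj; rewrite mxE (negbTE lNj) andbF mulr0.
Qed.

Lemma gradient_nmf_loss W : gradient (fun W' => nmf_loss V W' H) W = loss_grad W.
Proof.
apply/matrixP => i j; rewrite mxE -[RHS]mxdot_delta.
set D := delta_mx i j; set b := mxdot _ _.
pose c := 2^-1 * mxdot (D *m H) (D *m H).
apply: cvg_lim => //.
(* By the exact expansion, the difference quotient in direction [D] is [b + h * c] for nonzero h. *)
have lin_cvg : (fun h : R => b + h * c) @ 0^' --> b.
  have lin_cont : continuous (fun h : R => b + h * c).
    by move=> x; apply: cvgD; [exact: cvg_cst|apply: cvgMr_tmp; exact: cvg_id].
  have := lin_cont 0; rewrite /continuous_at mul0r addr0.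
  by apply: cvg_trans; apply: cvg_app; exact: cvg_within.
apply: cvg_trans lin_cvg; apply: near_eq_cvg; near=> h.
have h_neq0 : h != 0 by near: h; exact: nbhs_dnbhs_neq.
rewrite /= [h *: D + W]addrC nmf_loss_expand -/b -/c /GRing.scale /=.
by field.
Unshelve. all: by end_near. Qed.

Lemma grad_step_nonexpansive (lambda : R) W1 W2 :
  0 <= lambda -> lambda * frobenius (H^T *m H) <= 2 ->
  mxdot (W1 - lambda *: loss_grad W1 - (W2 - lambda *: loss_grad W2))
        (W1 - lambda *: loss_grad W1 - (W2 - lambda *: loss_grad W2))
  <= mxdot (W1 - W2) (W1 - W2).
Proof.
move=> lambda_ge0 lambda_le; set D := W1 - W2.
(* [V] cancels in the difference, so the step acts linearly on [D]. *)
have -> : W1 - lambda *: loss_grad W1 - (W2 - lambda *: loss_grad W2) =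
    D + (- lambda) *: (D *m H *m H^T).
  have -> : D *m H *m H^T = loss_grad W1 - loss_grad W2.
    by rewrite /loss_grad -mulmxBl; congr (_ *m _); rewrite opprB addrA subrK mulmxBl.
  by rewrite scaleNr scalerBr /D !opprB addrACA [RHS]addrACA [_ - W2]addrC.
rewrite mxdot_add_scale -mxdot_mulmxl.
have gram := mxdot_gram_le (D *m H) H.
have DH_ge0 := mxdot_ge0 (D *m H).
(* One factor [lambda] absorbs the Gram norm; multiplying by [lambda] once more bounds the quadratic
   term by the negative cross term. *)
have scaled_gram : lambda * mxdot (D *m H *m H^T) (D *m H *m H^T) <=
    2 * mxdot (D *m H) (D *m H).
  apply: (le_trans (ler_wpM2l lambda_ge0 gram)).
  by rewrite mulrA ler_wpM2r.
by have := ler_wpM2l lambda_ge0 scaled_gram; lra.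
Qed.

(** By convexity the segment from [W] to [D] stays feasible, so the loss increment along it is
    nonnegative and its slope at [W] cannot be negative. *)
Lemma argmin_nmf_loss_grad_ge0 W D :
  argmin (@nonneg_mx R M r) (fun W => nmf_loss V W H) W -> nonneg_mx D ->
  0 <= mxdot (loss_grad W) (D - W).
Proof.
move=> [/nonneg_mxP W_ge0 W_min] /nonneg_mxP D_ge0.
set a := mxdot _ _; set E := D - W.
pose c := 2^-1 * mxdot (E *m H) (E *m H).
have c_ge0 : 0 <= c by rewrite mulr_ge0 ?invr_ge0 ?mxdot_ge0.
have segment t : 0 <= t <= 1 -> 0 <= t * a + t ^+ 2 * c.
  move=> /andP[t_ge0 t_le1].
  have /W_min : nonneg_mx (W + t *: E).
    apply/nonneg_mxP => i j; rewrite !mxE.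
    by have := W_ge0 i j; have := D_ge0 i j; nra.
  by rewrite nmf_loss_expand -/c -/a; lra.
exact: segment_slope_ge0 segment.
Qed.

Lemma fixed_points_pospart_step (lambda : R) : 0 < lambda ->
  fixed_points (fun W => pospart (W - lambda *: loss_grad W)) =
  argmin (@nonneg_mx R M r) (fun W => nmf_loss V W H).
Proof.
move=> lambda_gt0; apply/seteqP; split=> W /=.
  move=> W_fix; split=> [|B /nonneg_mxP B_ge0].
    by rewrite -W_fix; exact: pospart_nonneg.
  (* The expansion at t = 1 leaves a nonnegative quadratic term, so only the linear term matters. *)
  have -> : B = W + 1 *: (B - W) by rewrite scale1r addrC subrK.
  rewrite nmf_loss_expand mul1r expr1n mul1r -addrA lerDl addr_ge0//; last first.
    by rewrite mulr_ge0 ?invr_ge0 ?mxdot_ge0.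
  rewrite mxdotE; apply: sumr_ge0 => i _; apply: sumr_ge0 => j _.
  have /matrixP/(_ i j) := W_fix; have := B_ge0 i j; rewrite !mxE.
  (* Scaled by [lambda], the gradient entry g matches the fixed-point equation w = max(0, w - g):
     either g = 0, or w = 0 and g > 0. Both give g (b - w) >= 0. *)
  rewrite -(pmulr_rge0 _ lambda_gt0) mulrA.
  set g := lambda * _; set b := B i j; set w := W i j.
  by case: (leP 0 (w - g)) => *; nra.
move=> W_argmin; have [/nonneg_mxP W_ge0 _] := W_argmin.
rewrite /fixed_points /=; set P := pospart _.
have GD_ge0 :=
  argmin_nmf_loss_grad_ge0 W_argmin (pospart_nonneg (W - lambda *: loss_grad W)).
apply/eqP; rewrite -subr_eq0; apply/eqP/mxdot_eq0/eqP.
rewrite eq_le mxdot_ge0 andbT.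
(* With p an entry of [P], each summand is (p - w)(p - (w - lambda g)): it vanishes if p = w -
   lambda g, and is w (w - lambda g) <= 0 if p = 0. Together with [GD_ge0] this forces [P = W]. *)
suff : mxdot (P - W) (P - W) + lambda * mxdot (loss_grad W) (P - W) <= 0.
  by have := mulr_ge0 (ltW lambda_gt0) GD_ge0; rewrite -/P; lra.
rewrite !mxdotE mulr_sumr -big_split /=; apply: sumr_le0 => i _.
rewrite mulr_sumr -big_split /=; apply: sumr_le0 => j _.
have PE : P i j = Num.max 0 (W i j - lambda * loss_grad W i j) by rewrite !mxE.
have := W_ge0 i j; rewrite [(P - W) i j]mxE [(- W) i j]mxE PE.
set g := loss_grad W i j; set w := W i j.
by case: (leP 0 (w - lambda * g)) => *; nra.
Qed.

End Loss.

Theorem proposition2p2 (R : realType) (M N r : nat)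
    (M_gt0 : (0 < M)%N) (N_gt0 : (0 < N)%N) (r_gt0 : (0 < r)%N)
    (r_lt : (r < minn M N)%N)
    (V : 'M[R]_(M, N)) (V_ge0 : nonneg_mx V)
    (H : 'M[R]_(r, N)) (lambda : R) (lambda_ge0 : 0 <= lambda)
    (lambda_le : H != 0 -> lambda <= 2 / frobenius (H^T *m H)) :
  [/\ forall W : 'M[R]_(M, r),
        nmf_step V H lambda W =
        metric_proj (@nonneg_mx R M r) (W - lambda *: ((W *m H - V) *m H^T)),
      forall W1 W2 : 'M[R]_(M, r),
        frobenius (nmf_step V H lambda W1 - nmf_step V H lambda W2)
        <= frobenius (W1 - W2)
    & 0 < lambda ->
      fixed_points (nmf_step V H lambda) =
      argmin (@nonneg_mx R M r) (fun W => nmf_loss V W H)].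
Proof.
have stepE W : nmf_step V H lambda W = pospart (W - lambda *: loss_grad V H W).
  by rewrite /nmf_step gradient_nmf_loss metric_proj_nonneg.
have lambda_frob : lambda * frobenius (H^T *m H) <= 2.
  (* A zero norm makes the product 0; a nonzero one forces [H != 0], so [lambda_le] applies. *)
  have [->|frob_neq0] := eqVneq (frobenius (H^T *m H)) 0; first by rewrite mulr0.
  have frob_gt0 : 0 < frobenius (H^T *m H).
    by rewrite lt_neqAle eq_sym frob_neq0 frobenius_ge0.
  rewrite -ler_pdivlMr//; apply: lambda_le; apply: contraNneq frob_neq0 => ->.
  by rewrite frobeniusE mulmx0 /mxdot mul0mx mxtrace0 sqrtr0.
split=> [W|W1 W2|lambda_gt0].
- by rewrite stepE metric_proj_nonneg.
- rewrite !stepE ler_frobenius; apply: (le_trans (pospart_nonexpansive _ _)).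
  exact: grad_step_nonexpansive.
- by rewrite (funext stepE) fixed_points_pospart_step.
Qed.
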